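(* Let $G$ be a finite simple connected graph with $\gamma(G)=1$, let $n,m\geq 2$, and let $H=G\circ\overline{K_n}$. Then $\gamma_{P,c}(H\,\square\,P_m)=2$.
   Context: Power domination: for $S\subseteq V(X)$, start with $M(S)=N[S]$ and repeatedly add a vertex $w$ whenever some $v\in M(S)$ has $w$ as its unique neighbour outside $M(S)$; $S$ is a connected power dominating set if the final $M(S)$ is $V(X)$ and $\langle S\rangle$ is connected; $\gamma_{P,c}(X)$ is the minimum size of such a set. $\gamma(G)$ is the domination number. $\overline{K_n}$ is the edgeless graph on $n$ vertices. The lexicographic product $G\circ K$ has vertex set $V(G)\times V(K)$, with $(a,b)\sim(x,y)$ iff $ax\in E(G)$, or $a=x$ and $by\in E(K)$. The Cartesian product $H\,\square\,P_m$ has vertex set $V(H)\times V(P_m)$, with $(a,b)\sim(x,y)$ iff either $a=x$ and $by\in E(P_m)$, or $b=y$ and $ax\in E(H)$. $P_m$ is the path on $m$ vertices.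
   Formalization: The formal theorem assumes that G has at least two vertices; for G = K_1 the graph H is edgeless, H □ P_m is n ≥ 2 disjoint paths, and no connected power dominating set exists, so the claim fails there. *)

(* Defs.v *)
From mathcomp Require Import all_boot.

Set Implicit Arguments.
Unset Strict Implicit.
Unset Printing Implicit Defensive.

Record sgraph := SGraph {
  vertex :> finType;
  adj : rel vertex;
  adj_sym : symmetric adj;
  adj_irr : irreflexive adj
}.
Arguments adj {s} x y.

(* The graph without vertices does not count as connected. *)
Definition connected_graph (X : sgraph) : Prop :=
  0 < #|X| /\ forall x y : X, connect adj x y.

Section Graphs.
Variable X : sgraph.
Implicit Types (S D M : {set X}) (v w : X).

Definition open_nbh v : {set X} := [set w | adj v w].

Definition closed_nbh S : {set X} := S :|: \bigcup_(v in S) open_nbh v.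

Definition induced_adj S : rel {x : X | x \in S} :=
  fun x y => adj (val x) (val y).

Lemma induced_adj_sym S : symmetric (@induced_adj S).
Proof. by move=> x y; apply: adj_sym. Qed.

Lemma induced_adj_irr S : irreflexive (@induced_adj S).
Proof. by move=> x; apply: adj_irr. Qed.

Definition induced S : sgraph :=
  SGraph (@induced_adj_sym S) (@induced_adj_irr S).

Definition dominating D : Prop := closed_nbh D = [set: X].

(* [monitoring S M]: the set M occurs at some stage of a run of the monitoring
   process started at S. Which vertex is added first is left free: the
   final set of a run does not depend on these choices. *)
Inductive monitoring S : {set X} -> Prop :=
| monitoring_init : monitoring S (closed_nbh S)
| monitoring_step M v w :
    monitoring S M -> v \in M -> open_nbh v :\: M = [set w] ->
    monitoring S (w |: M).

Definition power_dominating S : Prop := monitoring S [set: X].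

Definition connected_power_dominating S : Prop :=
  power_dominating S /\ connected_graph (induced S).

(* Relational, so that the minimum has no value at all when no set satisfies
   P (as for connected power dominating sets of a disconnected graph). *)
Definition is_min_size (P : {set X} -> Prop) (k : nat) : Prop :=
  (exists2 S, P S & #|S| = k) /\ (forall S, P S -> k <= #|S|).

End Graphs.

Definition is_domination_number (X : sgraph) (k : nat) : Prop :=
  is_min_size (@dominating X) k.

Definition is_connected_power_domination_number (X : sgraph) (k : nat) : Prop :=
  is_min_size (@connected_power_dominating X) k.

Definition edgeless_adj n : rel 'I_n := fun _ _ => false.

Lemma edgeless_adj_sym n : symmetric (@edgeless_adj n).
Proof. by []. Qed.

Lemma edgeless_adj_irr n : irreflexive (@edgeless_adj n).
Proof. by []. Qed.

Definition edgeless n : sgraph :=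
  SGraph (@edgeless_adj_sym n) (@edgeless_adj_irr n).

Definition path_adj m : rel 'I_m :=
  fun i j => (i.+1 == j :> nat) || (j.+1 == i :> nat).

Lemma path_adj_sym m : symmetric (@path_adj m).
Proof. by move=> i j; rewrite /path_adj orbC. Qed.

Lemma path_adj_irr m : irreflexive (@path_adj m).
Proof. by move=> i; rewrite /path_adj orbb eqn_leq ltnn. Qed.

Definition path_graph m : sgraph :=
  SGraph (@path_adj_sym m) (@path_adj_irr m).

Section Products.
Variables G K : sgraph.

Definition lex_adj : rel (G * K) :=
  fun p q => adj p.1 q.1 || (p.1 == q.1) && adj p.2 q.2.

Lemma lex_adj_sym : symmetric lex_adj.
Proof. by move=> p q; rewrite /lex_adj adj_sym eq_sym (adj_sym p.2). Qed.

Lemma lex_adj_irr : irreflexive lex_adj.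
Proof. by move=> p; rewrite /lex_adj !adj_irr andbF. Qed.

Definition lex_product : sgraph := SGraph lex_adj_sym lex_adj_irr.

Definition cart_adj : rel (G * K) :=
  fun p q => (p.1 == q.1) && adj p.2 q.2 || (p.2 == q.2) && adj p.1 q.1.

Lemma cart_adj_sym : symmetric cart_adj.
Proof.
by move=> p q; rewrite /cart_adj adj_sym (adj_sym p.1) eq_sym (eq_sym p.2).
Qed.

Lemma cart_adj_irr : irreflexive cart_adj.
Proof. by move=> p; rewrite /cart_adj !adj_irr !andbF. Qed.

Definition cart_product : sgraph := SGraph cart_adj_sym cart_adj_irr.

End Products.

(* Main.v *)
Require Import Defs.
From mathcomp Require Import all_boot.

Set Implicit Arguments.
Unset Strict Implicit.
Unset Printing Implicit Defensive.

(** Let [u] be a dominating vertex of [G] and [v] a neighbour of [u]; the copies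
    of the edge [uv] in the first layer of [H [] P_m] dominate that layer, and a
    fully monitored layer forces the next one, vertex by vertex. Conversely, a
    singleton [{((x, i), b)}] monitors nothing beyond its closed neighbourhood,
    which misses [((x, j), b)] for [j != i]: a neighbour [((y, k), b)] also has an
    unmonitored neighbour in an adjacent layer, and a neighbour [((x, i), c)]
    has at least [n] unmonitored neighbours in its own layer. *)

(** The monitoring process can add nothing to [M]. *)
Definition stalled (X : sgraph) (M : {set X}) : bool :=
  [forall v in M, #|open_nbh v :\: M| != 1].

Section Monitoring.
Variable X : sgraph.
Implicit Types (S M : {set X}) (v w : X).

Lemma closed_nbh1 v w : (w \in closed_nbh [set v]) = (w == v) || adj v w.
Proof. by rewrite /closed_nbh big_set1 !inE. Qed.

Lemma stalled_monitoring S M :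
  stalled (closed_nbh S) -> monitoring S M -> M = closed_nbh S.
Proof.
move=> /forall_inP stS; elim=> [//|{}M v w _ -> vS dv].
by have := stS v vS; rewrite dv cards1.
Qed.

(** Each step shrinks the complement of [M], so every run can be continued until it gets stuck. *)
Lemma monitoring_extend S M : monitoring S M ->
  exists M', [/\ monitoring S M', M \subset M' & stalled M'].
Proof.
have [k] := ubnP #|~: M|; elim: k M => // k IHk M ltMk monM.
have [stM | /forall_inPn[v vM /negbNE/cards1P[w dv]]] := boolP (stalled M).
  by exists M; split.
have wM : w \notin M.
  have : w \in open_nbh v :\: M by rewrite dv set11.
  by rewrite inE => /andP[].
have [|M' [monM' sM' stM']] := IHk _ _ (monitoring_step monM vM dv).
  rewrite -ltnS; apply: leq_trans ltMk; rewrite ltnS proper_card //.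
  by rewrite properC properE subsetUr subUset sub1set (negPf wM).
by exists M'; split=> //; apply: subset_trans sM'; apply: subsetUr.
Qed.

(** Removes the need to exhibit an explicit order of forcing steps: only the sets where a run can
    stop are examined. *)
Lemma power_dominating_stalled S :
  (forall M, closed_nbh S \subset M -> stalled M -> M = [set: X]) ->
  power_dominating S.
Proof.
move=> closS; have [M [monM sSM stM]] := monitoring_extend (monitoring_init S).
by rewrite /power_dominating -(closS M).
Qed.

Lemma stalled_intro M :
  (forall v, v \in M -> open_nbh v \subset M \/
     exists a b, [/\ a != b, adj v a, adj v b, a \notin M & b \notin M]) ->
  stalled M.
Proof.
move=> stM; apply/forall_inP => v /stM[|[a [b [ab va vb aM bM]]]].
  by rewrite -setD_eq0 => /eqP->; rewrite cards0.
apply/cards1P => -[w dv]; case/eqP: ab.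
have /set1P-> : a \in [set w] by rewrite -dv !inE aM.
by apply/esym/set1P; rewrite -dv !inE bM.
Qed.

Lemma connected_induced2 v w : adj v w -> connected_graph (induced [set v; w]).
Proof.
move=> vw; split.
  by apply/card_gt0P; exists (exist _ v (set21 v w)).
move=> x y; have [-> | xy] := eqVneq x y; first exact: connect0.
apply: connect1; move: xy; case: x y => [x xvw] [y yvw].
rewrite -val_eqE /= /induced_adj /=.
by case/set2P: xvw => ->; case/set2P: yvw => ->; rewrite ?eqxx // adj_sym.
Qed.

Lemma connected_graph_nbh : connected_graph X -> 1 < #|X| ->
  forall v, exists w, adj v w.
Proof.
move=> [_ conX] ltX v.
have /card_gt0P[y] : 0 < #|predC1 v| by rewrite cardC1 -subn1 subn_gt0.
rewrite inE => /eqP yv; have /connectP[[|w p]] := conX v y.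
  by move=> _ yv'; case: yv.
by move=> /= /andP[vw _] _; exists w.
Qed.

End Monitoring.

Lemma path_graph_nbh m (i : path_graph m) : 1 < m -> exists j, adj i j.
Proof.
move=> ltm; have [lti | lei] := ltnP i.+1 m.
  by exists (Ordinal lti); rewrite /= /path_adj /= eqxx.
(* At the last vertex, [1 < m] leaves room for a predecessor. *)
have i_gt0 : 0 < i by rewrite -ltnS; apply: leq_trans lei.
exists (Ordinal (leq_ltn_trans (leq_pred i) (ltn_ord i))).
by rewrite /= /path_adj /= prednK // eqxx orbT.
Qed.

Lemma cart_path_power_dominating (X : sgraph) m (D : {set X}) :
  dominating D ->
  power_dominating (setX D [set ord0] : {set cart_product X (path_graph m.+1)}).
Proof.
move=> domD; apply: power_dominating_stalled => M sDM /forall_inP stM.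
(* All layers up to [k] are treated together, since forcing from layer [k] also requires layer
   [k - 1] to be monitored. *)
suff layer k (x : X) (i : 'I_m.+1) : i <= k -> (x, i) \in M.
  by apply/setP=> -[x i]; rewrite inE (layer i).
elim: k x i => [|k IHk] x i lik.
  have -> : i = ord0 by apply/val_inj/eqP; rewrite -leqn0.
  apply: (subsetP sDM); have : x \in closed_nbh D by rewrite domD inE.
  rewrite !inE /= => /orP[xD | /bigcupP[y yD]]; first by rewrite xD eqxx.
  rewrite inE => yx; apply/orP; right; apply/bigcupP.
  exists (y, ord0); first by rewrite !inE yD eqxx.
  by rewrite inE /= /cart_adj /= ?eqxx yx orbT.
have [lik' | lki] := leqP i k; first exact: IHk.
have ltk : k < m.+1 by apply: ltn_trans (ltn_ord i).
have ei : i = k.+1 :> nat by apply/eqP; rewrite eqn_leq lik.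
(* If [(x, k.+1)] were missing, it would be the only unmonitored neighbour of [(x, k)], and [M]
   would not be stalled. *)
apply: contraT => xiM; case/negP: (stM (x, Ordinal ltk) (IHk x (Ordinal ltk) (leqnn k))).
apply/cards1P; exists (x, i); apply/setP => -[y j].
rewrite !inE /= /cart_adj /= /path_adj /=.
apply/andP/eqP => [[yjM] | [-> ->]]; last by rewrite xiM ei !eqxx.
case/orP=> [/andP[/eqP<- /orP[/eqP kj | /eqP jk]] | /andP[/eqP kj _]].
- by congr (_, _); apply/val_inj; rewrite /= ei.
- by rewrite IHk // -jk leqnSn in yjM.
- by rewrite -kj IHk in yjM.
Qed.

(** The vertex [(u, i)] is adjacent to everything except the copies of [u], and those are all
    adjacent to [(v, i)]. *)
Lemma lex_edgeless_dominating (G : sgraph) n (u v : G) (i : edgeless n) :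
  dominating [set u] -> adj u v ->
  dominating ([set (u, i); (v, i)] : {set lex_product G (edgeless n)}).
Proof.
move=> domu uv; apply/setP => -[x j]; rewrite [RHS]inE inE.
apply/orP; right; apply/bigcupP.
have [-> | xu] := eqVneq x u.
  by exists (v, i); rewrite ?set22 // inE /= /lex_adj /= adj_sym uv.
exists (u, i); rewrite ?set21 // inE /= /lex_adj /=.
have : x \in closed_nbh [set u] by rewrite domu inE.
by rewrite closed_nbh1 (negPf xu) /= => ->.
Qed.

Lemma cart_lex_edgeless_stalled1 (G : sgraph) n m
    (s : cart_product (lex_product G (edgeless n)) (path_graph m)) :
  (forall x : G, exists y, adj x y) -> 1 < n -> 1 < m ->
  stalled (closed_nbh [set s]) /\ closed_nbh [set s] <> [set: _].
Proof.
case: s => [[x i] b] nbhG ltn ltm.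
set HP := cart_product (lex_product G (edgeless n)) (path_graph m).
set s : HP := (_, b).
have [j ji] : exists j : 'I_n, j != i.
  have /card_gt0P[j] : 0 < #|predC1 i| by rewrite cardC1 card_ord -subn1 subn_gt0.
  by exists j.
(* Another copy of [x] in the layer of [s] is not adjacent to [s]. *)
have twin : ((x, j, b) : HP) \notin closed_nbh [set s].
  by rewrite closed_nbh1 /= /cart_adj /= /lex_adj /= !adj_irr !xpair_eqE
    (eq_sym i) (negPf ji) /= !andbF.
split; last by move=> nbhT; rewrite nbhT inE in twin.
(* An edge of the Cartesian product never changes both the vertex of [G] and the layer. *)
have off y k c : x != y -> adj b c -> ((y, k, c) : HP) \notin closed_nbh [set s].
  move=> xy bc; rewrite closed_nbh1 /= /cart_adj /= !xpair_eqE.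
  rewrite eq_sym (negPf xy) /=; apply: contraTN bc => /andP[/eqP-> _].
  by rewrite adj_irr.
have adj_neq (y z : G) : adj y z -> y != z.
  by apply: contraTneq => ->; rewrite adj_irr.
apply: stalled_intro => -[[y k] c]; rewrite closed_nbh1.
case/orP=> [/eqP-> | ].
  by left; apply/subsetP=> w; rewrite closed_nbh1 inE orbC => ->.
(* A neighbour of [s] in another layer sees two copies of some [z] adjacent to [x]; a neighbour in
   the layer of [s] sees the twin of [s] and its own copy in an adjacent layer. *)
rewrite /= /cart_adj /= => /orP[/andP[/eqP[<- <-] bc] | /andP[/eqP<- xy]]; right.
  have [z xz] := nbhG x.
  exists ((z, i), c), ((z, j), c); split; try exact: off (adj_neq _ _ xz) bc.
  - by rewrite !xpair_eqE (eq_sym i) (negPf ji) andbF.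
  - by rewrite /cart_adj /= eqxx /lex_adj /= xz orbT.
  - by rewrite /cart_adj /= eqxx /lex_adj /= xz orbT.
have {}xy : adj x y by move: xy; rewrite /lex_adj /= andbF orbF.
have [d bd] := path_graph_nbh b ltm.
exists ((x, j), b), ((y, k), d); split=> //; last exact: off (adj_neq _ _ xy) bd.
- by rewrite !xpair_eqE (negPf (adj_neq _ _ xy)).
- by rewrite /cart_adj /= eqxx /lex_adj /= adj_sym xy orbT.
- by rewrite /cart_adj /= eqxx; move: bd => /= ->.
Qed.

Unset Implicit Arguments.

(* The hypothesis hG1 excludes G = K_1, for which H is edgeless on n >= 2
   vertices and H [] P_m has no connected power dominating set at all. *)
Theorem theorem10 (G : sgraph) (n m : nat)
    (hGconn : connected_graph G) (hG1 : 1 < #|G|)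
    (hdom : is_domination_number G 1) (hn : 2 <= n) (hm : 2 <= m) :
  is_connected_power_domination_number
    (cart_product (lex_product G (edgeless n)) (path_graph m)) 2.
Proof.
have nbhG := connected_graph_nbh hGconn hG1.
split=> [|S [pdS [S_gt0 _]]].
  case: hdom => -[D domD /eqP/cards1P[u eD]] _; rewrite {}eD in domD.
  have [v uv] := nbhG u.
  case: m hm => // m' _; pose i : edgeless n := Ordinal (ltnW hn).
  pose a : cart_product (lex_product G (edgeless n)) (path_graph m'.+1) :=
    ((u, i), ord0).
  pose b : cart_product (lex_product G (edgeless n)) (path_graph m'.+1) :=
    ((v, i), ord0).
  have ab : adj a b by rewrite /= /cart_adj /= /lex_adj /= uv orbT.
  exists [set a; b]; last first.
    by rewrite cards2; case: eqP ab => // ->; rewrite adj_irr.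
  split; last exact: connected_induced2.
  suff <- : setX [set (u, i); (v, i)] [set ord0] = [set a; b].
    exact/cart_path_power_dominating/lex_edgeless_dominating.
  apply/setP => -[[x j] c]; rewrite !inE /= /a /b !xpair_eqE.
  by case: (c == ord0); rewrite ?andbT ?andbF.
(* Connectedness of the induced graph includes having a vertex, which rules out size 0; only
   singletons remain. *)
have {}S_gt0 : 0 < #|S| by rewrite -(card_sig (mem S)).
rewrite ltn_neqAle S_gt0 andbT; apply/negP; rewrite eq_sym => /cards1P[s eS].
have [stS neqT] := cart_lex_edgeless_stalled1 s nbhG hn hm.
by apply: neqT; rewrite -eS in stS *; rewrite -(stalled_monitoring stS pdS).
Qed.
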